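(* Let $(\mathcal{M},\omega_A,V;1\le A\le k)$ be a $k$-symplectic manifold and let $H:\mathcal{M}\to\mathbb{R}$ be a smooth function. Let $\mathbf{X}=(X_1,\dots,X_k)$ be an integrable evolution $k$-vector field associated to $H$, i.e. $\mathbf{X}$ is integrable and $\sum_{A=1}^{k}i_{X_A}\omega_A=dH$. Suppose that $L_{X_A}\omega_A=0$ for each $A=1,\dots,k$ (no summation over $A$). Let $Y$ be a vector field on $\mathcal{M}$ which is a symmetry of $\mathbf{X}$, and let $\mathbf{Y}=(Y,\dots,Y)$ be the $k$-vector field all of whose $k$ components equal $Y$. If $S$ is a vector field on $\mathcal{M}$ which is a $\mathbf{Y}$-pseudosymmetry of $\mathbf{X}$, then the map $\mathbf{\Phi}=(\Phi_1,\dots,\Phi_k):\mathcal{M}\to\mathbb{R}^k$ defined by $$\Phi_A=\omega_A(S,Y),\qquad A=1,\dots,k,$$ is a conservation law for $\mathbf{X}=(X_1,\dots,X_k)$. In particular, if $Y$ and $S$ are symmetries of $\mathbf{X}$, then $\mathbf{\Phi}$ is a conservation law for $\mathbf{X}$.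
   Context: All manifolds, maps, vector fields and forms are $C^\infty$. $L_X$ denotes the Lie derivative (for vector fields $L_XY=[X,Y]$) and $i_X$ the interior product. A $k$-symplectic manifold $(\mathcal{M},\omega_A,V;1\le A\le k)$ is a manifold $\mathcal{M}$ of dimension $n+nk$ together with $k$ closed $2$-forms $\omega_1,\dots,\omega_k$ and an integrable distribution $V$ of rank $nk$ such that $\omega_A|_{V\times V}=0$ for all $A$ and $\bigcap_{A=1}^{k}\ker\omega_A=\{0\}$. A $k$-vector field on $\mathcal{M}$ is a section of the Whitney sum $T\mathcal{M}\oplus\cdots\oplus T\mathcal{M}$ ($k$ copies), i.e. a $k$-tuple $\mathbf{X}=(X_1,\dots,X_k)$ of vector fields on $\mathcal{M}$. An integral section of $\mathbf{X}$ at $x\in\mathcal{M}$ is a map $\psi:U_0\subset\mathbb{R}^k\to\mathcal{M}$, with $U_0$ an open neighbourhood of $0$, such that $\psi(0)=x$ and $\psi_*(t)\left(\frac{\partial}{\partial t^A}(t)\right)=X_A(\psi(t))$ for every $t\in U_0$ and every $A=1,\dots,k$. $\mathbf{X}$ is integrable if there is an integral section at every point of $\mathcal{M}$. A map $\mathbf{\Phi}=(\Phi_1,\dots,\Phi_k):\mathcal{M}\to\mathbb{R}^k$ is a conservation law for the $k$-vector field $\mathbf{X}$ if $\sum_{A=1}^{k}L_{X_A}\Phi_A=0$. A vector field $Y$ on $\mathcal{M}$ is a symmetry of $\mathbf{X}$ if $L_{X_A}Y=0$ for all $A=1,\dots,k$. Given a fixed $k$-vector field $\mathbf{Z}=(Z_1,\dots,Z_k)$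 on $\mathcal{M}$, a vector field $S$ on $\mathcal{M}$ is a $\mathbf{Z}$-pseudosymmetry of $\mathbf{X}$ if for every $A=1,\dots,k$ there are functions $\lambda_A^B\in C^\infty(\mathcal{M})$, $B=1,\dots,k$, such that $L_{X_A}S=\sum_{B=1}^{k}\lambda_A^B Z_B$. *)

(* Defs.v *)
From HB Require Import structures.
From mathcomp Require Import all_boot all_order all_algebra.
From mathcomp Require Import sesquilinear ring.
From mathcomp Require Import all_classical reals topology normedtype derive.

Set Implicit Arguments.
Unset Strict Implicit.
Unset Printing Implicit Defensive.

Import Order.TTheory GRing.Theory Num.Theory.
Import numFieldNormedType.Exports.

Local Open Scope classical_set_scope.
Local Open Scope ring_scope.

Definition evec (R : realType) (m : nat) (i : 'I_m) : 'rV[R]_m := delta_mx 0 i.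
Arguments evec {R m} i.

Section Smooth.
Context {R : realType} {m : nat}.
Implicit Types (U : set 'rV[R]_m) (f g : 'rV[R]_m -> R).

(* All partial derivatives of order at most r exist and are continuous on U.
   Only meaningful for open U. *)
Fixpoint Cr (r : nat) U f : Prop :=
  (forall x, U x -> {for x, continuous f}) /\
  (if r is r'.+1 then
     forall i, (forall x, U x -> derivable f x (evec i)) /\
               Cr r' U (fun x => 'D_(evec i) f x)
   else True).

Definition smooth_on U f : Prop := forall r, Cr r U f.

Lemma CrW r U f : Cr r.+1 U f -> Cr r U f.
Proof.
elim: r f => [|r IH] f /= [cf df]; first by split.
by split=> // i; have [dfi Cf] := df i; split=> //; apply: IH.
Qed.

Lemma eq_Cr r U f g : open U -> (forall x, U x -> f x = g x) ->
  Cr r U f -> Cr r U g.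
Proof.
move=> Uo; elim: r f g => [|r IH] f g fg Hf.
all: have nfg x : U x -> \near x, f x = g x
  by move=> Ux; apply: filterS fg _; exact: open_nbhs_nbhs.
all: have cfg : (forall x, U x -> {for x, continuous f}) ->
    forall x, U x -> {for x, continuous g}
  by move=> cf x Ux; rewrite /prop_for /continuous_at -(fg x Ux);
     apply: cvg_trans (cf x Ux); exact: near_eq_cvg (nfg x Ux).
  by move: Hf => /= [cf _]; split=> //; exact: cfg.
move: Hf => /= [cf df]; split=> [|i]; first exact: cfg.
have [dfi Cf] := df i; split.
  by move=> x Ux; apply: near_eq_derivable (dfi x Ux); exact: nfg.
by apply: IH Cf => x Ux; apply: near_eq_derive; exact: nfg.
Qed.

Lemma Cr_cst r U (a : R) : open U -> Cr r U (cst a).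
Proof.
move=> Uo; elim: r a => [|r IH] a /=; first by split=> // x _; exact: cst_continuous.
split=> [x _|i]; first exact: cst_continuous.
split=> [x _|]; first exact: derivable_cst.
by apply: eq_Cr (IH 0) => // x _; rewrite derive_cst.
Qed.

Lemma CrD r U f g : open U -> Cr r U f -> Cr r U g -> Cr r U (f + g).
Proof.
move=> Uo; elim: r f g => [|r IH] f g /= [cf df] [cg dg];
  (split=> [x Ux|]; first by exact: cvgD (cf x Ux) (cg x Ux)); first by [].
move=> i; have [dfi Cf] := df i; have [dgi Cg] := dg i; split=> [x Ux|].
  by apply: derivableD; [exact: dfi|exact: dgi].
apply: eq_Cr (IH _ _ Cf Cg) => // x Ux.
by rewrite deriveD //; [exact: dfi|exact: dgi].
Qed.

Lemma CrM r U f g : open U -> Cr r U f -> Cr r U g -> Cr r U (f * g).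
Proof.
move=> Uo; elim: r f g => [|r IH] f g Hf Hg.
  by move: Hf Hg => /= [cf _] [cg _]; split=> // x Ux;
    exact: cvgM (cf x Ux) (cg x Ux).
have Wf := CrW Hf; have Wg := CrW Hg.
move: Hf Hg => /= [cf df] [cg dg]; split=> [x Ux|i].
  by exact: cvgM (cf x Ux) (cg x Ux).
have [dfi Cf] := df i; have [dgi Cg] := dg i; split=> [x Ux|].
  by apply: derivableM; [exact: dfi|exact: dgi].
apply: eq_Cr (CrD Uo (IH _ _ Wf Cg) (IH _ _ Wg Cf)) => // x Ux.
by rewrite deriveM //; [exact: dfi|exact: dgi].
Qed.

End Smooth.

(* The inverse par of coord is a total function whose values outside
   coord @` dom are irrelevant. *)
Record chart (R : realType) (M : topologicalType) (m : nat) := Chart {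
  dom : set M;
  coord : M -> 'rV[R]_m;
  par : 'rV[R]_m -> M;
  dom_open : open dom;
  codom_open : open (coord @` dom);
  coordK : forall x, dom x -> par (coord x) = x;
  coord_cont : forall x, dom x -> {for x, continuous coord};
  par_cont : forall u, (coord @` dom) u -> {for u, continuous par} }.

Record manifold (R : realType) (m : nat) := Manifold {
  msort :> topologicalType;
  manifold_hausdorff : hausdorff_space msort;
  manifold_second_countable : @second_countable msort;
  atlas : set (chart R msort m);
  atlas_cover : forall x, exists2 c, atlas c & dom c x;
  atlas_compat : forall c d, atlas c -> atlas d -> forall j : 'I_m,
    smooth_on (coord c @` (dom c `&` dom d))
              (fun u => coord d (par c u) 0 j) }.

Section SmoothFunctions.
Context {R : realType} {m : nat} (M : manifold R m).

Definition smooth (f : M -> R^o) : Prop :=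
  forall c, @atlas _ _ M c -> smooth_on (coord c @` dom c) (f \o par c).

Definition smoothp : pred (M -> R^o) := fun f => `[< smooth f >].

Record cinf := Cinf { cinf_fun : M -> R^o; _ : smoothp cinf_fun }.

HB.instance Definition _ := [isSub for cinf_fun].
HB.instance Definition _ := [Choice of cinf by <:].

Lemma smoothp_subring : subring_closed smoothp.
Proof.
have c1 (a : R) : smooth (cst a).
  by move=> c _ r; exact: Cr_cst (@codom_open _ _ _ c).
have cD f g : smooth f -> smooth g -> smooth (f + g).
  move=> sf sg c ac r.
  by apply: CrD; [exact: codom_open|exact: sf|exact: sg].
have cM f g : smooth f -> smooth g -> smooth (f * g).
  move=> sf sg c ac r.
  by apply: CrM; [exact: codom_open|exact: sf|exact: sg].
split=> [|f g /asboolP sf /asboolP sg|f g /asboolP sf /asboolP sg];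
  apply/asboolP; [exact: c1| |exact: cM].
apply: cD => //; suff -> : - g = cst (-1) * g :> (M -> R^o) by exact: cM.
by apply/funext => x; rewrite !fctE mulN1r.
Qed.

HB.instance Definition _ := GRing.SubChoice_isSubComPzRing.Build _ smoothp cinf
  smoothp_subring.

Lemma smoothp_submod : submod_closed smoothp.
Proof.
have [s1 sB sM] := smoothp_subring.
have s0 : 0 \in smoothp by rewrite -(subrr 1) sB.
split=> // a f g sf sg; rewrite -[g]opprK sB //; last by rewrite -[- g]add0r sB.
suff -> : a *: f = cst a * f :> (M -> R^o).
  apply: sM => //; apply/asboolP => c _ r; exact: Cr_cst (@codom_open _ _ _ c).
by [].
Qed.

HB.instance Definition _ := GRing.SubZmodule_isSubLmodule.Build R _ smoothp cinf
  (GRing.submod_closed_semi smoothp_submod).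

End SmoothFunctions.

Coercion cinf_fun : cinf >-> Funclass.

Section Tangent.
Context {R : realType} {m : nat} (M : manifold R m) (x : M).

Definition derivation_at (v : cinf M -> R^o) : Prop :=
  linear v /\ forall f g : cinf M, v (f * g) = f x * v g + g x * v f.

Definition derivation_atp : pred (cinf M -> R^o) :=
  fun v => `[< derivation_at v >].

(* The tangent space at x: point derivations of the algebra of smooth
   functions. *)
Record tangent := Tangent {
  tangent_fun : cinf M -> R^o; _ : derivation_atp tangent_fun }.

HB.instance Definition _ := [isSub for tangent_fun].
HB.instance Definition _ := [Choice of tangent by <:].

Lemma derivation_atp_submod : submod_closed derivation_atp.
Proof.
split=> [|a v w /asboolP[lv dv] /asboolP[lw dw]]; apply/asboolP; split.
- by move=> b f g; rewrite /= scaler0 addr0.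
- by move=> f g; rewrite /= !mulr0 addr0.
- move=> b f g; rewrite !fctE lv lw !scalerDr !scalerA.
  by rewrite [a * b]mulrC addrACA.
- move=> f g; rewrite !fctE dv dw !scalerDr addrACA !mulrDr.
  by congr (_ + _ + (_ + _)); exact: mulrCA.
Qed.

HB.instance Definition _ := GRing.SubChoice_isSubLmodule.Build R _ derivation_atp
  tangent (GRing.submod_closed_semi derivation_atp_submod).

End Tangent.

Coercion tangent_fun : tangent >-> Funclass.

Section Maps.
Context {R : realType} {m : nat} {M : manifold R m}.

Definition is_basis (x : M) (r : nat) (E : 'I_r -> tangent x)
    (W : set (tangent x)) : Prop :=
  (forall a : 'I_r -> R, \sum_i a i *: E i = 0 -> forall i, a i = 0) /\
  W = [set \sum_i a i *: E i | a in [set: 'I_r -> R]].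

Definition smooth_map (r : nat) (U : set 'rV[R]_r) (psi : 'rV[R]_r -> M) : Prop :=
  (forall t, U t -> {for t, continuous psi}) /\
  forall c, @atlas _ _ M c -> forall j : 'I_m,
    smooth_on (U `&` psi @^-1` dom c) (fun t => coord c (psi t) 0 j).

(* psi_* at t of the i-th coordinate vector, as an operator on smooth functions *)
Definition push_coord (r : nat) (psi : 'rV[R]_r -> M) (t : 'rV[R]_r) (i : 'I_r)
    (f : cinf M) : R :=
  'D_(evec i) (fun s => f (psi s) : R^o) t.

End Maps.

Section VectorFields.
Context {R : realType} {m : nat}.

(* A family of tangent vectors is a smooth field iff it maps smooth functions to
   smooth functions. *)
Record vfield (M : manifold R m) := VField {
  vfield_fun :> forall x : M, tangent x;
  vfield_smooth : forall f : cinf M, smooth (fun x => vfield_fun x f) }.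

Context {M : manifold R m}.
Implicit Types (X Y Z : vfield M) (f : cinf M).

(* L_X f = X f *)
Definition lie_fun X f : cinf M :=
  Cinf (introT (asboolP _) (vfield_smooth X f)).

Definition bracket_fun X Y (x : M) : cinf M -> R^o :=
  fun f => X x (lie_fun Y f) - Y x (lie_fun X f).

Lemma tangentP (x : M) (v : tangent x) : derivation_at x v.
Proof. by case: v => v /= /asboolP. Qed.

Lemma lie_funP X (a : R) f g :
  lie_fun X (a *: f + g) = a *: lie_fun X f + lie_fun X g.
Proof. by apply/val_inj/funext => x; exact: (tangentP (X x)).1 a f g. Qed.

Lemma lie_funM X f g : lie_fun X (f * g) = f * lie_fun X g + g * lie_fun X f.
Proof. by apply/val_inj/funext => x; exact: (tangentP (X x)).2 f g. Qed.

Lemma tangentD (x : M) (v : tangent x) f g : v (f + g) = v f + v g.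
Proof. by have [lv _] := tangentP v; have := lv 1 f g; rewrite !scale1r. Qed.

Lemma bracket_subproof X Y (x : M) : derivation_atp x (bracket_fun X Y x).
Proof.
apply/asboolP; rewrite /bracket_fun; split=> [a f g|f g].
  have [lX _] := tangentP (X x); have [lY _] := tangentP (Y x).
  by rewrite !lie_funP lX lY opprD addrACA scalerBr.
have [_ dX] := tangentP (X x); have [_ dY] := tangentP (Y x).
rewrite !lie_funM !tangentD !dX !dY /=.
rewrite !mulrBr !opprD !addrA.
move: (f x) (g x) (X x f) (X x g) (Y x f) (Y x g) => fx gx a b c d.
move: (X x _) (X x _) (Y x _) (Y x _) => p q r t.
by rewrite /GRing.scale /=; ring.
Qed.

Lemma bracket_smooth X Y f :
  smooth (fun x => Tangent (bracket_subproof X Y x) f).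
Proof.
exact/asboolP/(valP (lie_fun X (lie_fun Y f) - lie_fun Y (lie_fun X f))).
Qed.

(* L_X Y = [X, Y] *)
Definition lie_vfield X Y : vfield M := VField (bracket_smooth X Y).

(* A family of alternating bilinear forms is smooth iff it is so on all pairs of
   smooth vector fields. *)
Record form2 (M' : manifold R m) := Form2 {
  form2_fun :> forall x : M', {biscalar (tangent x)};
  form2_alt : forall x (v : tangent x), form2_fun x v v = 0;
  form2_smooth : forall Y Z : vfield M',
    smooth (fun x => form2_fun x (Y x) (Z x)) }.

Implicit Types omega : form2 M.

(* omega(Y, Z) *)
Definition form2_eval omega Y Z : cinf M :=
  Cinf (introT (asboolP _) (form2_smooth omega Y Z)).

Definition interior X omega (x : M) (v : tangent x) : R := omega x (X x) v.

Definition differential f (x : M) (v : tangent x) : R := v f.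

(* Invariant formula for the exterior derivative, (d omega)(X, Y, Z). *)
Definition d_form2 omega X Y Z : cinf M :=
  lie_fun X (form2_eval omega Y Z) - lie_fun Y (form2_eval omega X Z)
  + lie_fun Z (form2_eval omega X Y)
  - form2_eval omega (lie_vfield X Y) Z + form2_eval omega (lie_vfield X Z) Y
  - form2_eval omega (lie_vfield Y Z) X.

Definition closed_form2 omega : Prop := forall X Y Z, d_form2 omega X Y Z = 0.

Definition ker_form2 omega (x : M) : set (tangent x) :=
  [set v | forall w, omega x v w = 0].

(* (L_X omega)(Y, Z): the Lie derivative of tensor fields is the derivation
   that commutes with contractions and agrees with lie_fun on functions and
   with lie_vfield on vector fields. *)
Definition lie_form2 X omega Y Z : cinf M :=
  lie_fun X (form2_eval omega Y Z)
  - form2_eval omega (lie_vfield X Y) Z - form2_eval omega Y (lie_vfield X Z).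

(* By bump functions, global frame fields spanning D near x exist as soon as
   local ones do. *)
Record distribution (M' : manifold R m) (r : nat) := Distribution {
  distribution_set :> forall x : M', set (tangent x);
  distribution_smooth : forall x : M', exists E : 'I_r -> vfield M',
    \forall y \near x, is_basis (fun i => E i y) (@distribution_set y) }.
Arguments distribution_set {M' r} _ x _.

(* Through every point passes an integral manifold, given by an injective
   immersion psi of an open set of R^r. *)
Definition integrable_distribution (r : nat) (D : distribution M r) : Prop :=
  forall x : M, exists (U : set 'rV[R]_r) (psi : 'rV[R]_r -> M),
    [/\ open U /\ U 0, smooth_map U psi, psi 0 = x,
        {in U &, injective psi} &
        forall t, U t -> exists2 E : 'I_r -> tangent (psi t),
          forall i f, E i f = push_coord psi t i f & is_basis E (D (psi t))].

Section KVectorFields.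
Context {k : nat}.
Implicit Types XX ZZ : 'I_k -> vfield M.

Definition integral_section XX (x : M) (U : set 'rV[R]_k) (psi : 'rV[R]_k -> M)
    : Prop :=
  [/\ open U /\ U 0, smooth_map U psi, psi 0 = x &
      forall t, U t -> forall A f, push_coord psi t A f = XX A (psi t) f].

Definition integrable XX : Prop :=
  forall x, exists U psi, integral_section XX x U psi.

Definition conservation_law XX (Phi : 'I_k -> cinf M) : Prop :=
  \sum_A lie_fun (XX A) (Phi A) = 0.

Definition symmetry XX Y : Prop := forall A x, lie_vfield (XX A) Y x = 0.

Definition pseudosymmetry ZZ XX (S : vfield M) : Prop :=
  forall A, exists lambda : 'I_k -> cinf M, forall x,
    lie_vfield (XX A) S x = \sum_B lambda B x *: ZZ B x.

Definition evolution (omega : 'I_k -> form2 M) (H : cinf M) XX : Prop :=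
  forall x (v : tangent x),
    \sum_A interior (XX A) (omega A) v = differential H v.

End KVectorFields.

End VectorFields.

Arguments distribution_set {R m M' r} _ x _.
Arguments ker_form2 {R m M} omega x _.

Record ksymplectic (R : realType) (n k : nat) := KSymplectic {
  ks_manifold :> manifold R (n + n * k);
  ks_form : 'I_k -> form2 ks_manifold;
  ks_dist : distribution ks_manifold (n * k);
  ks_closed : forall A, closed_form2 (ks_form A);
  ks_integrable : integrable_distribution ks_dist;
  ks_isotropic : forall A (x : ks_manifold) (v w : tangent x),
    ks_dist x v -> ks_dist x w -> ks_form A x v w = 0;
  ks_nondegenerate : forall x : ks_manifold,
    \bigcap_A ker_form2 (ks_form A) x = [set 0] }.

(* Main.v *)
Require Import Defs.
From mathcomp Require Import all_boot all_order all_algebra.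
From mathcomp Require Import sesquilinear boolp reals topology.

(** By the Leibniz rule for the Lie derivative of a 2-form
    ([lie_fun_form2_eval]),
      X (omega (S, Y)) =
        (L_X omega) (S, Y) + omega ([X, S], Y) + omega (S, [X, Y]).
    Take X = X_A and omega = omega_A. The first term vanishes because
    L_{X_A} omega_A = 0, and the last because Y is a symmetry. In the middle
    one, [X_A, S] is at every point a multiple of Y, since all components of
    the k-vector field defining the pseudosymmetry equal Y; so the term is a
    multiple of omega_A (Y, Y), which is 0 because omega_A is alternating
    ([form2_sum_multiples]). Thus each X_A (Phi_A), and not only their sum, is
    zero. A symmetry is a pseudosymmetry with zero coefficients, which gives
    the second claim. *)

Import GRing.Theory.
Local Open Scope ring_scope.

Section LieDerivative.
Context {R : realType} {m : nat} {M : manifold R m}.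
Implicit Types (X Y S : vfield M) (omega : form2 M).

(** The Leibniz rule is the formula defining the Lie derivative of a 2-form,
    solved for the derivative of the function. *)
Lemma lie_fun_form2_eval omega X S Y (x : M) :
  lie_fun X (form2_eval omega S Y) x =
  lie_form2 X omega S Y x + omega x (lie_vfield X S x) (Y x)
  + omega x (S x) (lie_vfield X Y x).
Proof.
(* The subtractions of cinf M are pointwise by conversion only. *)
have -> : lie_form2 X omega S Y x = lie_fun X (form2_eval omega S Y) x
    - omega x (lie_vfield X S x) (Y x) - omega x (S x) (lie_vfield X Y x) by [].
by rewrite addrAC !subrK.
Qed.

Lemma form2_sum_multiples omega (x : M) (v : tangent x) (I : finType)
    (a : I -> R) :
  omega x (\sum_i a i *: v) v = 0.
Proof. by rewrite -scaler_suml linearZl_LR /= form2_alt mulr0. Qed.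

Lemma symmetry_pseudosymmetry k (ZZ XX : 'I_k -> vfield M) S :
  symmetry XX S -> pseudosymmetry ZZ XX S.
Proof.
move=> symS A; exists (fun=> 0) => x.
by rewrite symS big1 // => B _; rewrite scale0r.
Qed.

End LieDerivative.

Theorem theorem5p6 (R : realType) (n k : nat) (M : ksymplectic R n k)
    (H : cinf M) (XX : 'I_k -> vfield M)
    (XX_integrable : integrable XX)
    (XX_evolution : evolution (@ks_form R n k M) H XX)
    (XX_lie : forall A (Z W : vfield M),
      lie_form2 (XX A) (ks_form M A) Z W = 0%R)
    (Y : vfield M) (Y_symmetry : symmetry XX Y) :
  (forall S : vfield M, pseudosymmetry (fun _ : 'I_k => Y) XX S ->
     conservation_law XX (fun A => form2_eval (ks_form M A) S Y)) /\
  (forall S : vfield M, symmetry XX S ->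
     conservation_law XX (fun A => form2_eval (ks_form M A) S Y)).
Proof.
have pseudo S : pseudosymmetry (fun _ : 'I_k => Y) XX S ->
    conservation_law XX (fun A => form2_eval (ks_form M A) S Y).
  move=> pseudoS; apply: big1 => A _.
  have [lambda lieS] := pseudoS A.
  apply/val_inj/funext => x.
  rewrite [LHS]lie_fun_form2_eval XX_lie lieS Y_symmetry.
  by rewrite form2_sum_multiples linear0r !addr0.
by split=> // S symS; apply/pseudo/symmetry_pseudosymmetry.
Qed.
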